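(* Let $0<\alpha<1$ be irrational, let $T$ be the rotation $Tx=x+\alpha$ modulo $1$ on $[0,1[$ (viewed as a $2$-interval exchange with discontinuity $1-\alpha$), let $N\ge2$, let $0<\zeta_1<\zeta_2<1$ and $a_1,a_2,a_3\in\mathbb{Z}$, and let $T_f(x,s)=(Tx,s+f(x))$ on $[0,1[\times\mathbb{Z}/N\mathbb{Z}$, where $f=a_1$ on $[0,\zeta_1[$, $f=a_2$ on $[\zeta_1,\zeta_2[$ and $f=a_3$ on $[\zeta_2,1[$. Then: (1) if $0<\zeta_1=2\alpha<\zeta_2<1$ and $\zeta_2\notin\mathbb{Z}(\alpha)$, $T_f$ is minimal if and only if $(N,2a_1,a_2,a_3)=1$; (2) if $0<\zeta_1<\zeta_2=2\alpha<1$ and $\zeta_1\notin\mathbb{Z}(\alpha)$, $T_f$ is minimal if and only if $(N,a_1+a_2,2a_2,a_3)=1$; (3) if $0<\zeta_1=2\alpha<\zeta_2=3\alpha<1$, $T_f$ is minimal if and only if $(N,2a_1+a_2,a_3)=1$.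
   Context: Intervals are semi-open. $\mathbb{Z}(\alpha)=\{m\alpha+n: m,n\in\mathbb{Z}\}$. The values $a_i$ of $f$ are reduced modulo $N$. $(N,\dots)=1$ means that the greatest common divisor is $1$, with $0$ divisible by every integer. Minimal means every orbit is dense, $[0,1[\times\{s\}$ carrying the usual interval topology. *)

(* Defs.v *)
From mathcomp Require Import all_boot all_order all_algebra.
From mathcomp Require Import all_classical all_reals topology normedtype.

Set Implicit Arguments.
Unset Strict Implicit.
Unset Printing Implicit Defensive.

Import Order.TTheory GRing.Theory Num.Theory numFieldNormedType.Exports.

Local Open Scope classical_set_scope.
Local Open Scope ring_scope.

Section Rotation.
Context {R : realType}.
Implicit Types (alpha zeta x : R).

Definition Zspan alpha : set R :=
  [set x | exists m n : int, x = m%:~R * alpha + n%:~R].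

(* The translation is reduced modulo 1 by removing the integer part; [rotationE] is
   its description as an exchange of two intervals. *)
Definition rotation alpha x : R := x + alpha - (Num.floor (x + alpha))%:~R.

Lemma rotationE alpha x : 0 < alpha < 1 -> 0 <= x < 1 ->
  rotation alpha x = if x < 1 - alpha then x + alpha else x + alpha - 1.
Proof.
move=> /andP[a0 a1] /andP[x0 x1]; rewrite /rotation ltrBrDr.
case: ltP => xa1.
- have -> : Num.floor (x + alpha) = 0.
    by apply: floor_def; rewrite add0r xa1 andbT addr_ge0 // ltW.
  by rewrite subr0.
- have -> // : Num.floor (x + alpha) = 1.
  by apply: floor_def; rewrite xa1 /= intrD ltrD.
Qed.

Definition step3 (zeta1 zeta2 : R) (a1 a2 a3 : int) (x : R) : int :=
  if x < zeta1 then a1 else if x < zeta2 then a2 else a3.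

Section Extension.
Variable N : nat.

(* Only the values on `[0, 1[ `*` setT matter. 'Z_N is Z/NZ for 1 < N. *)
Definition skew_product (T : R -> R) (f : R -> int) (p : R * 'Z_N) : R * 'Z_N :=
  (T p.1, p.2 + (f p.1)%:~R).

Definition phase_space : set (R * 'Z_N) := `[0, 1[%classic `*` setT.

(* Two-sided orbit {F^n p, n in Z} of an invertible map F of the phase space:
   q = F^(-n) p is written F^n q = p. *)
Definition orbitZ (F : R * 'Z_N -> R * 'Z_N) (p : R * 'Z_N) :
    set (R * 'Z_N) :=
  [set q | phase_space q /\ exists n, iter n F p = q \/ iter n F q = p].

(* 'Z_N is discrete, so density is density in each level [0, 1[ x {s}. *)
Definition dense_in_phase_space (A : set (R * 'Z_N)) :=
  forall s : 'Z_N, `[0, 1[%classic `<=` closure [set x | A (x, s)].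

Definition minimal (F : R * 'Z_N -> R * 'Z_N) :=
  forall p, phase_space p -> dense_in_phase_space (orbitZ F p).

End Extension.
End Rotation.

Definition gcdzs (s : seq int) : int := \big[gcdz/0]_(a <- s) a.

(* Main.v *)
Require Import Defs.
From mathcomp Require Import all_boot all_order all_algebra.
From mathcomp Require Import all_classical all_reals topology normedtype.
From mathcomp Require Import ring lra zify.

Set Implicit Arguments.
Unset Strict Implicit.
Unset Printing Implicit Defensive.

Import Order.TTheory GRing.Theory Num.Theory numFieldNormedType.Exports.

Local Open Scope classical_set_scope.
Local Open Scope ring_scope.

(** Lift the rotation to R: the forward orbit of (x0, t0) becomes the set of
    points x0 + n alpha + k carrying the levels t0 + F(x0) + ... +
    F(x0 + (n-1) alpha), where F is the 1-periodic lift of f mod N.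

    If minimality fails, the limit sets of a forward orbit detect it.  For a
    point x and a side of x let A(x, side) be the set of levels which the orbit
    visits in every punctured one-sided neighbourhood of x.  These sets are
    nonempty, A(x + alpha) contains the translate of A(x) by the one-sided limit
    of F, and A(y) is contained in A(x) for y close to x on the given side.
    Density of the rotation turns the two inclusions into inequalities between
    cardinals that go around in circles, so all the A(x, side) have the same
    cardinal ([card_limit_set]) and both inclusions are equalities
    ([limit_set_step], [limit_set_near]).  The A(x, side) are the fibres of an
    orbit closure over the circle with its cut points doubled; they play the part
    of the transfer function g in a coboundary equation f = g o T - g.

    Say that x is a jump when its two limit sets differ.  The translates of x by
    n alpha, n >= 0, come close to x, where the two limit sets agree; hence the
    forward orbit of a jump meets a discontinuity of F, and so does its strict
    backward orbit ([jump_orbit]).  When all discontinuities are among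
    0, alpha, ..., L alpha and one point xi outside Z(alpha), this confines the
    jumps to alpha, ..., L alpha modulo 1 ([jump_location]).  With A = A(0, right),
    the limit set is therefore A on [0, alpha[, the translate of A by
    F(0) + ... + F((L-1) alpha) on [L alpha, 1[, and there is no jump at 0 = 1.
    So A is invariant under F(0) + ... + F((L-1) alpha), under the last value a3,
    and under the difference of the values around xi.  In the three cases these
    elements generate the numbers listed in the gcd; when the gcd is 1, A is
    invariant under 1, hence is everything, and every orbit is dense
    ([minimal_step3]).

    If the gcd d is larger than 1, then c = N/d is nonzero in Z/N and c f is
    constant on each [i alpha, (i+1) alpha[ with i < L, zero on [L alpha, 1[, and
    its L values add up to 0.  Such a function is the coboundary of the staircase
    of its partial sums ([not_minimal_staircase]), which gives a nonconstant
    invariant.  Here L = 2 in the first two cases and L = 3 in the last. *)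

(** * Density of the orbits of an irrational rotation *)

Section Density.
Context {R : realType}.
Implicit Types (alpha x y a b e : R).

Lemma irrational_free alpha (m n : int) :
  irrational alpha -> m%:~R * alpha + n%:~R = 0 -> m = 0.
Proof.
move=> irr mn0; have [//|m0] := eqVneq m 0; case: irr.
exists ((- n)%:~R / m%:~R : rat) => //.
rewrite fmorph_div/= !ratr_int intrN.
have mR : m%:~R != 0 :> R by rewrite intr_eq0.
apply: (mulfI mR); rewrite mulrCA divff// mulr1; lra.
Qed.

Lemma irrational_opp alpha : irrational alpha -> irrational (- alpha).
Proof.
by move=> irr [q _ qa]; apply: irr; exists (- q) => //; rewrite rmorphN/= qa opprK.
Qed.

(** Pigeonhole: among M + 1 multiples of alpha, two have fractional parts in the
    same interval of length 1/M. *)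
Lemma small_translation alpha e : irrational alpha -> 0 < e ->
  exists (n : nat) (k : int), 0 < `|n%:R * alpha + k%:~R| < e.
Proof.
move=> irr e0; pose M := (Num.truncn e^-1).+1.
have M0 : 0 < M%:R :> R by rewrite ltr0n.
have MeE : M%:R^-1 < e.
  by rewrite invf_plt ?posrE//; exact: truncnS_gt.
pose u (i : nat) : R := i%:R * alpha - (Num.floor (i%:R * alpha))%:~R.
have u01 i : 0 <= u i < 1.
  by have := floor_itv (i%:R * alpha); rewrite intrD /u; lra.
have Mu i : 0 <= M%:R * u i < M%:R.
  by have := u01 i; nra.
have tu i : (Num.truncn (M%:R * u i) < M)%N.
  have /andP[u0 u1] := Mu i.
  by rewrite -(ltr_nat R); apply: le_lt_trans u1; rewrite truncn_le.
pose f (i : 'I_M.+1) : 'I_M := Ordinal (tu i).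
have /injectivePn[i [j ij fij]] : ~~ injectiveb f.
  by apply/injectiveP => /leq_card; rewrite !card_ord ltnn.
wlog lij : i j ij fij / (i < j)%N => [hw|].
  have [/hw|/hw|/ord_inj ijE] := ltngtP i j; first exact.
    by apply; [rewrite eq_sym|].
  by rewrite ijE eqxx in ij.
exists (j - i)%N, (Num.floor (i%:R * alpha) - Num.floor (j%:R * alpha)).
have -> : (j - i)%:R * alpha + (Num.floor (i%:R * alpha) -
    Num.floor (j%:R * alpha))%:~R = u j - u i.
  by rewrite natrB ?(ltnW lij)// intrB /u; ring.
apply/andP; split.
  rewrite normr_gt0; apply/eqP => uij.
  have : (Posz (j - i)) = 0.
    apply: (irrational_free (n := Num.floor (i%:R * alpha) -
      Num.floor (j%:R * alpha)) irr).
    by rewrite -pmulrn natrB ?(ltnW lij)// intrB -uij /u; ring.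
  lia.
apply: lt_trans MeE; rewrite -(ltr_pM2l M0) divff ?gt_eqF//.
rewrite -[X in X * `|_|](gtr0_norm M0) -normrM mulrBr.
have /andP[i0 i1] := truncn_itv (andP (Mu i)).1.
have /andP[j0 j1] := truncn_itv (andP (Mu j)).1.
have fijE : Num.truncn (M%:R * u i) = Num.truncn (M%:R * u j).
  by move/(congr1 val): fij.
rewrite fijE in i0 i1; rewrite -[X in _ < X]natr1 in i1; rewrite -[X in _ < X]natr1 in j1.
rewrite ltr_norml. lra.
Qed.

(** A progression of step shorter than the interval cannot jump over it. *)
Lemma arithmetic_hit x a b d : 0 < d -> d < b - a ->
  exists (j : nat) (k : int), a < x + k%:~R + j%:R * d < b.
Proof.
move=> d0 dab; pose k := Num.floor (a - x).
have ak : 0 <= (a - x - k%:~R) / d.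
  by rewrite divr_ge0 ?(ltW d0)// subr_ge0 floor_le.
exists (Num.truncn ((a - x - k%:~R) / d)).+1, k.
have := truncn_itv ak; rewrite ler_pdivlMr// ltr_pdivrMr// -natr1; lra.
Qed.

Lemma dense_orbit alpha x a b : irrational alpha -> a < b ->
  exists (n : nat) (k : int), a < x + n%:R * alpha + k%:~R < b.
Proof.
move=> irr ab; have ba : 0 < b - a by rewrite subr_gt0.
have [n [k /andP[d0 db]]] := small_translation irr ba.
set d := _ + _ in d0 db.
suff [j [l h]] : exists (j : nat) (l : int), a < x + l%:~R + j%:R * d < b.
  exists (j * n)%N, (l + j%:Z * k).
  by move: h; rewrite natrM intrD intrM -pmulrn /d; lra.
have [dp|dn] := ltP 0 d.
  by rewrite gtr0_norm// in db; exact: arithmetic_hit.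
rewrite ler0_norm// in d0 db.
have [|j [l h]] := @arithmetic_hit (- x) (- b) (- a) (- d) d0; first lra.
by exists j, (- l); rewrite mulrNz; lra.
Qed.

End Density.

(** * Periods of subsets of a finite group *)

Section Translate.
Context {G : finZmodType}.
Implicit Types (g h t : G) (A : {set G}).

Definition translate g A : {set G} := finset (fun t => t - g \in A).

Lemma in_translate g A t : (t \in translate g A) = (t - g \in A).
Proof. by rewrite inE. Qed.

Lemma translate0 A : translate 0 A = A.
Proof. by apply/setP => t; rewrite in_translate subr0. Qed.

Lemma translateD g h A : translate h (translate g A) = translate (g + h) A.
Proof. by apply/setP => t; rewrite !in_translate opprD addrA addrAC. Qed.

Lemma translateK g A : translate (- g) (translate g A) = A.
Proof. by rewrite translateD subrr translate0. Qed.

Lemma translate_inj g : injective (translate g).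
Proof. exact: can_inj (translateK g). Qed.

Lemma card_translate g A : #|translate g A| = #|A|.
Proof.
rewrite -(card_imset A (addIr g)); apply: eq_card => t; rewrite in_translate.
apply/idP/imsetP => [tA|[u uA ->]]; last by rewrite addrK.
by exists (t - g); rewrite ?subrK.
Qed.

End Translate.

Section Periods.
Context {G : finZmodType}.
Implicit Types (g h : G) (A : {set G}) (k : int).

Definition period A g := translate g A = A.

Lemma period0 A : period A 0.
Proof. exact: translate0. Qed.

Lemma periodD A g h : period A g -> period A h -> period A (g + h).
Proof. by rewrite /period => gA hA; rewrite -translateD gA. Qed.

Lemma periodN A g : period A g -> period A (- g).
Proof. by rewrite /period => {1}<-; exact: translateK. Qed.

Lemma periodB A g h : period A g -> period A h -> period A (g - h).
Proof. by move=> gA /periodN; exact: periodD. Qed.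

Lemma periodMz A g k : period A g -> period A (g *~ k).
Proof.
move=> gA; have gAn n : period A (g *+ n).
  elim: n => [|n IHn]; first exact: period0.
  by rewrite mulrSr; exact: periodD.
by case: k => n; [exact: gAn|rewrite NegzE mulrNz; exact/periodN/gAn].
Qed.

End Periods.

(** * One-sided limit sets of an orbit *)

Section Sides.
Context {R : realType}.
Implicit Types (s : bool) (x y z e alpha : R) (k : int).

(** The side is a boolean, true for the right, so that both one-sided theories
    share their statements. *)
Definition near_side s x e y : Prop :=
  if s then x < y < x + e else x - e < y < x.
#[global] Arguments near_side !s x e y /.

Lemma near_side_le s x e e' y :
  e <= e' -> near_side s x e y -> near_side s x e' y.
Proof. by case: s => /= ? ?; lra. Qed.

Lemma near_sideD s x e y z : near_side s x e y -> near_side s (x + z) e (y + z).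
Proof. by case: s => /= ?; lra. Qed.

Lemma near_side_open s x e y : near_side s x e y -> exists2 d, 0 < d &
  forall s' z, near_side s' y d z -> near_side s x e z.
Proof.
have open_itv (a b : R) : a < y -> y < b -> exists2 d, 0 < d &
    forall s' z, near_side s' y d z -> a < z < b.
  move=> ay yb; exists (Num.min (y - a) (b - y)).
    by rewrite lt_min !subr_gt0 ay.
  have m1 : Num.min (y - a) (b - y) <= y - a by rewrite ge_min lexx.
  have m2 : Num.min (y - a) (b - y) <= b - y by rewrite ge_min lexx orbT.
  by case=> z /= ?; lra.
by case: s => /= /andP[]; exact: open_itv.
Qed.

Lemma near_side_orbit alpha s x y e :
  irrational alpha -> 0 < e ->
  exists n k, near_side s x e (y + n%:R * alpha + k%:~R).
Proof.
move=> alpha_irr e0; case: s => /=; apply: dense_orbit => //; lra.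
Qed.

End Sides.

Section LimitSets.
Context {R : realType} {G : finZmodType}.
Context (alpha : R) (alpha_irr : irrational alpha).
Context (F : R -> G) (Fs : bool -> R -> G).

Context (F_per : forall (x : R) (k : int), F (x + k%:~R) = F x).
Context (Fs_per : forall s (x : R) (k : int), Fs s (x + k%:~R) = Fs s x).
Context (F_side : forall s (x : R), exists2 e : R, 0 < e &
  forall y, near_side s x e y -> F y = Fs s x).
Context (x0 : R) (t0 : G).
Implicit Types (s : bool) (x y z e : R) (t : G) (n : nat) (k : int).

Definition level n : G := t0 + \sum_(i < n) F (x0 + i%:R * alpha).

Definition limit_set s x : {set G} := finset (fun t =>
  `[< forall e, 0 < e -> exists n k,
      near_side s x e (x0 + n%:R * alpha + k%:~R) /\ level n = t >]).

Lemma limit_setP s x t : reflect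
  (forall e, 0 < e -> exists n k,
      near_side s x e (x0 + n%:R * alpha + k%:~R) /\ level n = t)
  (t \in limit_set s x).
Proof. by rewrite inE; exact: asboolP. Qed.

(** There are finitely many levels, so one radius serves for all those that are
    not limit levels. *)
Lemma limit_set_radius s x : exists2 e, 0 < e &
  forall n k, near_side s x e (x0 + n%:R * alpha + k%:~R) ->
    level n \in limit_set s x.
Proof.
have : forall t, exists e, 0 < e /\ (t \notin limit_set s x ->
    forall n k, near_side s x e (x0 + n%:R * alpha + k%:~R) -> level n != t).
  move=> t; case: (boolP (t \in limit_set s x)) => [_|/limit_setP/existsNP[e]].
    by exists 1; split.
  move=> /not_implyP[e0 eN].
  exists e; split => // _ n k nk; apply/eqP => lt; apply: eN.
  by exists n, k.
move=> /choice[r rP].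
pose e := \big[Num.min/1]_(t : G) r t.
exists e.
  by rewrite /e; apply: lt_bigmin => // t _; exact: (rP t).1.
move=> n k nk; apply/negPn/negP => lN.
have /eqP[] := (rP _).2 lN n k (near_side_le (bigmin_le _ _ _) nk).
by [].
Qed.

Lemma limit_set_neq0 s x : limit_set s x != finset.set0.
Proof.
have [e e0 eP] := limit_set_radius s x.
have [n [k nk]] := near_side_orbit s x x0 alpha_irr e0.
by apply/set0Pn; exists (level n); exact: eP nk.
Qed.

Lemma limit_set_per s x k : limit_set s (x + k%:~R) = limit_set s x.
Proof.
wlog suff sub : x k / limit_set s (x + k%:~R) \subset limit_set s x.
  apply/eqP; rewrite finset.eqEsubset sub/=.
  by have := sub (x + k%:~R) (- k); rewrite mulrNz addrK.
apply/fintype.subsetP => t /limit_setP tx; apply/limit_setP => e e0.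
have [n [l [nl <-]]] := tx e e0; exists n, (l - k); split => //.
by have := near_sideD (- k%:~R) nl; rewrite addrK intrB !addrA.
Qed.

(** Near x on the given side F takes its one-sided limit value, so passing from
    time n to n + 1 moves visits near x to visits near x + alpha. *)
Lemma translate_limit_set_sub s x :
  translate (Fs s x) (limit_set s x) \subset limit_set s (x + alpha).
Proof.
apply/fintype.subsetP => t; rewrite in_translate => /limit_setP tx; apply/limit_setP => e e0.
have [d d0 dF] := F_side s x.
have de0 : 0 < Num.min d e by rewrite lt_min d0.
have [n [k [nk nt]]] := tx _ de0; exists n.+1, k; split.
  have le_e : Num.min d e <= e by rewrite ge_min lexx orbT.
  have := near_sideD alpha (near_side_le le_e nk).
  by rewrite -natr1 mulrDl mul1r; congr (near_side _ _ _ _); ring.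
rewrite /level big_ord_recr/= addrA -[t](subrK (Fs s x)) -nt; congr (_ + _).
rewrite -(F_per _ k); apply: dF; apply: near_side_le nk.
by rewrite ge_min lexx.
Qed.

Lemma limit_set_sub s s' x : exists2 e, 0 < e &
  forall y, near_side s x e y -> limit_set s' y \subset limit_set s x.
Proof.
have [e e0 eP] := limit_set_radius s x; exists e => // y xy.
have [d d0 dP] := near_side_open xy.
apply/fintype.subsetP => t /limit_setP/(_ d d0)[n [k [nk <-]]].
by apply: eP (k) _; exact: dP nk.
Qed.

(** Along the orbit of x the cardinal does not decrease, and this orbit enters the
    one-sided neighbourhood of y where limit sets are contained in that of y. *)
Lemma card_limit_set s x s' y : #|limit_set s x| = #|limit_set s' y|.
Proof.
wlog suff le_card : s x s' y / (#|limit_set s x| <= #|limit_set s' y|)%N.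
  by apply/eqP; rewrite eqn_leq !le_card.
have le_iter n : (#|limit_set s x| <= #|limit_set s (x + n%:R * alpha)|)%N.
  elim: n => [|n IHn]; first by rewrite mul0r addr0.
  apply: leq_trans IHn _.
  rewrite -natr1 mulrDl mul1r addrA -(card_translate (Fs s (x + n%:R * alpha))).
  exact: subset_leq_card (translate_limit_set_sub _ _).
have [e e0 eP] := limit_set_sub s' s y.
have [n [k nk]] := near_side_orbit s' y x alpha_irr e0.
by rewrite (leq_trans (le_iter n))// -(limit_set_per _ _ k) subset_leq_card// eP.
Qed.

Lemma limit_set_step s x :
  limit_set s (x + alpha) = translate (Fs s x) (limit_set s x).
Proof.
apply/esym/eqP; rewrite eqEcard translate_limit_set_sub card_translate.
by rewrite (card_limit_set _ _ s x) leqnn.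
Qed.

Lemma limit_set_near s x : exists2 e, 0 < e &
  forall s' y, near_side s x e y -> limit_set s' y = limit_set s x.
Proof.
have [e e0 eP] := limit_set_sub s true x.
have [e' e'0 eP'] := limit_set_sub s false x.
exists (Num.min e e'); first by rewrite lt_min e0.
move=> s' y xy; apply/eqP; rewrite eqEcard (card_limit_set _ _ s x) leqnn andbT.
case: s'; [apply: eP|apply: eP']; apply: near_side_le xy.
  by rewrite ge_min lexx.
by rewrite ge_min lexx orbT.
Qed.

Lemma limit_set_iter s x n : limit_set s (x + n%:R * alpha) =
  translate (\sum_(i < n) Fs s (x + i%:R * alpha)) (limit_set s x).
Proof.
elim: n => [|n IHn]; first by rewrite mul0r addr0 big_ord0 translate0.
by rewrite -natr1 mulrDl mul1r addrA limit_set_step IHn translateD big_ord_recr.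
Qed.

(** If F never distinguishes the two sides, both limit sets at x are translated by
    the same amount; once x + n alpha is close to x they coincide. *)
Lemma no_jump_forward x : (forall n,
    Fs true (x + n%:R * alpha) = Fs false (x + n%:R * alpha)) ->
  limit_set true x = limit_set false x.
Proof.
move=> reg; have [e e0 eP] := limit_set_near true x.
have [n [k nk]] := near_side_orbit true x x alpha_irr e0.
have /esym := etrans (eP false _ nk) (esym (eP true _ nk)).
rewrite !limit_set_per !limit_set_iter.
have -> : \sum_(i < n) Fs true (x + i%:R * alpha) =
    \sum_(i < n) Fs false (x + i%:R * alpha) by apply: eq_bigr.
exact: translate_inj.
Qed.

Lemma no_jump_backward x : (forall n,
    Fs true (x - n.+1%:R * alpha) = Fs false (x - n.+1%:R * alpha)) ->
  limit_set true x = limit_set false x.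
Proof.
move=> reg; have [e e0 eP] := limit_set_near true x.
have [n [k nk]] := near_side_orbit true x x (irrational_opp alpha_irr) e0.
set y := _ + _ in nk.
have -> : x = y + n%:R * alpha + (- k)%:~R by rewrite /y intrN; ring.
rewrite !limit_set_per !limit_set_iter (eP true _ nk) (eP false _ nk).
congr (translate _ _); apply: eq_bigr => i _.
have -> : y + i%:R * alpha = x - (n - i.+1).+1%:R * alpha + k%:~R.
  by rewrite subnSK// natrB 1?ltnW// /y; ring.
by rewrite !Fs_per reg.
Qed.

Lemma jump_orbit x : limit_set true x <> limit_set false x ->
  exists n m,
    Fs true (x + n%:R * alpha) <> Fs false (x + n%:R * alpha) /\
    Fs true (x - m.+1%:R * alpha) <> Fs false (x - m.+1%:R * alpha).
Proof.
move=> jx.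
have /existsNP[n hn] := contra_not (@no_jump_forward x) jx.
have /existsNP[m hm] := contra_not (@no_jump_backward x) jx.
by exists n, m.
Qed.

(** Being locally constant on each side, limit sets can only change at jumps: the
    infimum of the points where they differ from the one at a would be a jump. *)
Lemma limit_set_interval a b : a < b ->
  (forall x, a < x < b -> limit_set true x = limit_set false x) ->
  limit_set false b = limit_set true a.
Proof.
move=> ab nj; apply: contrapT => bb.
pose Z : set R := [set z | a < z <= b /\ limit_set false z <> limit_set true a].
have Zb : Z b by split; [rewrite ab lexx|].
have Zlb : lbound Z a by move=> z [/andP[/ltW]].
have [c c_lb c_max] : exists2 c, lbound Z c & forall w, lbound Z w -> w <= c.
  exists (inf Z); first by apply: ge_inf; exists a.
  by move=> w; apply: lb_le_inf; exists b.
have ac : a <= c by exact: c_max.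
have cb : c <= b by exact: c_lb.
have below z : a < z < c -> limit_set false z = limit_set true a.
  move=> /andP[az zc]; apply: contrapT => zN.
  have : c <= z; last by rewrite leNgt zc.
  by apply: c_lb; split => //; rewrite az (ltW (lt_le_trans zc cb)).
have cE : a < c -> limit_set false c = limit_set true a.
  move=> lac; have [e e0 eP] := limit_set_near false c.
  pose z := Num.max ((a + c) / 2) (c - e / 2).
  have z1 : (a + c) / 2 <= z by rewrite le_max lexx.
  have z2 : c - e / 2 <= z by rewrite le_max lexx orbT.
  have z3 : z < c by rewrite gt_max; apply/andP; split; lra.
  rewrite -(below z); last by apply/andP; split; lra.
  by apply/esym/eP => /=; lra.
have ltcb : c < b.
  rewrite lt_neqAle cb andbT; apply/eqP => cbE.
  by move: cE; rewrite cbE => /(_ ab).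
have cE' : limit_set true c = limit_set true a.
  move: ac; rewrite le_eqVlt => /predU1P[<-//|lac].
  by rewrite -cE//; apply: nj; rewrite lac.
have [e e0 eP] := limit_set_near true c.
have : c + e <= c; last by rewrite gerDl leNgt e0.
apply: c_max => z [/andP[az zb] zN]; rewrite leNgt; apply/negP => ze.
have cz : c <= z by apply: c_lb; split => //; rewrite az.
move: cz; rewrite le_eqVlt => /predU1P[czE|cz].
  by apply: zN; rewrite -czE cE// czE.
by apply: zN; rewrite -cE'; apply: eP => /=; rewrite cz.
Qed.

Lemma limit_set_translate s x : exists g, limit_set s x = translate g (limit_set true 0).
Proof.
have [e e0 eP] := limit_set_near s x.
have [n [k nk]] := near_side_orbit s x 0 alpha_irr e0.
rewrite -(eP true _ nk) limit_set_per limit_set_iter.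
by eexists.
Qed.

(** * Jumps and the periods they force *)

Section Relations.
Context (L : nat) (xi : R).
Context (F_disc : forall x, Fs true x <> Fs false x ->
  (exists i k, (i <= L)%N /\ x = i%:R * alpha + k%:~R) \/
  (~ Zspan alpha xi /\ exists k, x = xi + k%:~R)).

(** A jump x lies between two discontinuities of its orbit: x + n alpha is one and
    x - m alpha, m > 0, is another.  Both must be in Z(alpha), since xi is alone in
    its orbit, and then 1 <= j <= L by irrationality. *)
Lemma jump_location x : limit_set true x <> limit_set false x ->
  exists j k, (1 <= j <= L)%N /\ x = j%:R * alpha + k%:~R.
Proof.
move=> /jump_orbit[n [m [/F_disc dn /F_disc dm]]].
case: dn => [[i [k [iL nE]]]|[xiN [k nE]]];
  case: dm => [[i' [k' [iL' mE]]]|[xiN' [k' mE]]].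
- exists (i' + m.+1)%N, k'; split; last by rewrite natrD; lra.
  have : (i%:Z - n%:Z - i'%:Z - m.+1%:Z) = 0.
    apply: (irrational_free (n := k - k') alpha_irr).
    by rewrite !intrB -!pmulrn; lra.
  lia.
- case: xiN'; exists (i%:Z - n%:Z - m.+1%:Z), (k - k').
  by rewrite !intrB -!pmulrn; lra.
- case: xiN; exists (i'%:Z + n%:Z + m.+1%:Z), (k' - k).
  by rewrite !intrD !intrN -!pmulrn; lra.
- have : (n%:Z + m.+1%:Z) = 0.
    apply: (irrational_free (n := k' - k) alpha_irr).
    by rewrite !intrD !intrN -!pmulrn; lra.
  lia.
Qed.

Lemma no_jump0 : limit_set true 0 = limit_set false 0.
Proof.
apply: contrapT => /jump_location[j [k [jL /esym]]].
have := irrational_free (m := j%:Z) (n := k) alpha_irr.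
rewrite -pmulrn => h /h; lia.
Qed.

(** Neither x nor x + alpha is a jump, so the two one-sided limits of F translate
    the same set onto the same set. *)
Lemma period_transverse x : ~ Zspan alpha x ->
  period (limit_set true 0) (Fs true x - Fs false x).
Proof.
move=> xN; rewrite /period.
have nj y : ~ Zspan alpha y -> limit_set true y = limit_set false y.
  move=> yN; apply: contrapT => /jump_location[j [k [_ yE]]].
  by case: yN; exists j%:Z, k; rewrite -pmulrn.
have njS : limit_set true (x + alpha) = limit_set false (x + alpha).
  apply: nj => -[m [n E]]; apply: xN; exists (m - 1), n.
  by rewrite intrB; lra.
move: njS; rewrite !limit_set_step -(nj _ xN).
have [g ->] := limit_set_translate true x.
rewrite !translateD => /(congr1 (translate (- (g + Fs false x)))).
rewrite !translateD subrr translate0 => E; rewrite -[RHS]E; congr (translate _ _).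
by rewrite opprD addrACA subrr add0r.
Qed.

Context (alpha_gt0 : 0 < alpha) (L_lt1 : L%:R * alpha < 1).

(** Since L alpha < 1, the points alpha, ..., L alpha are already reduced modulo 1. *)
Lemma no_jump_away x : 0 < x < alpha \/ L%:R * alpha < x < 1 ->
  limit_set true x = limit_set false x.
Proof.
move=> hx; apply: contrapT => /jump_location[j [k [/andP[j1 jL] xE]]].
have j1R : alpha <= j%:R * alpha by rewrite -[leLHS]mul1r ler_pM2r// ler1n.
have jLR : j%:R * alpha <= L%:R * alpha by rewrite ler_pM2r// ler_nat.
have [Lalpha1 alpha0] := (L_lt1, alpha_gt0).
have [k0|[k0|k0]] : k <= -1 \/ k = 0 \/ 1 <= k by lia.
- have {k0} : k%:~R <= (-1)%:~R :> R by rewrite ler_int.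
  by rewrite mulrN1z => ?; case: hx => ?; lra.
- by move: xE; rewrite k0 mulr0z => ?; case: hx => ?; lra.
- have {k0} : (1 : int)%:~R <= k%:~R :> R by rewrite ler_int.
  by rewrite mulr1z => ?; case: hx => ?; lra.
Qed.

(** The last interval ends at the fixed cut 0 = 1, where there is no jump; its image
    ends at alpha, where the left limit set is again that of 0. *)
Lemma period_left_limit0 : period (limit_set true 0) (Fs false 0).
Proof.
rewrite /period {1}no_jump0 -limit_set_step add0r.
by apply: limit_set_interval => // x hx; apply: no_jump_away; left.
Qed.

(** Going from 0 to L alpha accumulates the sum; going on from L alpha to 1 = 0
    meets no jump. *)
Lemma period_sum :
  period (limit_set true 0) (\sum_(i < L) Fs true (i%:R * alpha)).
Proof.
rewrite /period; transitivity (limit_set true (L%:R * alpha)).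
  rewrite -[in RHS](add0r (_ * _)) limit_set_iter.
  by congr (translate _ _); apply: eq_bigr => i _; rewrite add0r.
rewrite no_jump0 -(limit_set_per false 0 1) add0r.
by apply/esym/limit_set_interval => // x hx; apply: no_jump_away; right.
Qed.

End Relations.

End LimitSets.

(** * Arithmetic of Z/N *)

Section Residues.
Context {N : nat}.
Implicit Types (A : {set 'Z_N}) (s : seq int).

Lemma period_gcdzs A s : (forall a, a \in s -> period A a%:~R) ->
  period A (gcdzs s)%:~R.
Proof.
rewrite /gcdzs; elim: s => [_|a s IHs sA]; first by rewrite big_nil; exact: period0.
rewrite big_cons; have [u [v <-]] := Bezoutz a (\big[gcdz/0]_(b <- s) b).
rewrite intrD mulrC [v * _]mulrC !mulrzA.
apply: periodD; apply: periodMz; first by apply: sA; rewrite mem_head.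
by apply: IHs => b bs; apply: sA; rewrite inE bs orbT.
Qed.

Lemma period1_full A : A != finset.set0 -> period A 1 -> A = [set: 'Z_N]%SET.
Proof.
move=> /set0Pn[u uA] A1; apply/setP => t; rewrite inE.
pose d : 'Z_N := t - u.
rewrite -(periodMz (nat_of_ord d) A1) in_translate -pmulrn natr_Zp.
by rewrite opprB addrC subrK.
Qed.

Lemma gcdzs_dvd s a : a \in s -> (gcdzs s %| a)%Z.
Proof.
rewrite /gcdzs; elim: s => // b s IHs; rewrite inE big_cons.
move=> /predU1P[->|/IHs]; first exact: dvdz_gcdl.
by apply: dvdz_trans; exact: dvdz_gcdr.
Qed.

(** The annihilator is N/d, with d the gcd. *)
Lemma common_annihilator s : (1 < N)%N -> gcdzs (N%:Z :: s) <> 1 ->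
  exists2 c : 'Z_N, c != 0 & forall a, a \in s -> c * a%:~R = 0.
Proof.
move=> N1 g1; set g := gcdzs _ in g1.
have gE : g = `|g|%N by rewrite /g /gcdzs big_cons.
have gN : (`|g| %| N)%N by have := @gcdzs_dvd (N%:Z :: s) N%:Z (mem_head _ _).
have N0 : (0 < N)%N by apply: ltnW.
have g0 : (0 < `|g|)%N := dvdn_gt0 N0 gN.
have gg1 : (1 < `|g|)%N.
  by rewrite ltn_neqAle g0 andbT; apply/eqP => gE1; rewrite gE -gE1 in g1.
exists (N %/ `|g|)%:R.
  apply/eqP => /(congr1 val); rewrite /= val_Zp_nat// modn_small ?ltn_Pdiv//.
  by apply/eqP; rewrite -lt0n divn_gt0// dvdn_leq.
move=> a as_; have : (g %| a)%Z by apply: gcdzs_dvd; rewrite inE as_ orbT.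
case/dvdzP => q ->; have gZ : g%:~R = `|g|%N%:R :> 'Z_N by rewrite {1}gE pmulrn.
rewrite intrM mulrCA gZ -natrM divnK//.
by rewrite pchar_Zp// mulr0.
Qed.

End Residues.

(** * From limit sets to the skew product *)

Section Lift.
Context {R : realType}.
Implicit Types (x y alpha : R) (k : int).

Definition fract x := x - (Num.floor x)%:~R.

Lemma fract_itv x : 0 <= fract x < 1.
Proof. by have := floor_itv x; rewrite intrD /fract; lra. Qed.

Lemma fract_def x k : 0 <= x - k%:~R < 1 -> fract x = x - k%:~R.
Proof.
by move=> xk; rewrite /fract (@floor_def _ _ k)// intrD; lra.
Qed.

Lemma fract_id x : 0 <= x < 1 -> fract x = x.
Proof. by move=> x01; rewrite (@fract_def x 0) subr0. Qed.

Lemma fractD x k : fract (x + k%:~R) = fract x.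
Proof.
have := floor_itv x; rewrite intrD => xk.
by rewrite (@fract_def _ (Num.floor x + k)) intrD /fract; lra.
Qed.

Lemma rotation_fract alpha x : rotation alpha (fract x) = fract (x + alpha).
Proof.
rewrite -[LHS]/(fract (fract x + alpha)) -[in RHS](fractD _ (- Num.floor x)).
by congr fract; rewrite intrN /fract; ring.
Qed.

Lemma iter_skew_product N (f : R -> int) alpha x (t : 'Z_N) n : 0 <= x < 1 ->
  iter n (skew_product (rotation alpha) f) (x, t) =
  (fract (x + n%:R * alpha),
   level alpha (fun y => (f (fract y))%:~R : 'Z_N) x t n).
Proof.
move=> x01; elim: n => [|n IHn] /=.
  by rewrite mul0r addr0 fract_id// /level big_ord0 addr0.
rewrite IHn /skew_product /= rotation_fract /level big_ord_recr/= addrA.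
by congr (fract _, _); rewrite -natr1; ring.
Qed.

(** The forward half of the orbit is already dense in each level. *)
Lemma minimal_limit_set N (f : R -> int) alpha :
  (forall (x0 : R) (t0 : 'Z_N) x, limit_set alpha
     (fun y => (f (fract y))%:~R) x0 t0 true x = [set: 'Z_N]%SET) ->
  minimal (@skew_product R N (rotation alpha) f).
Proof.
move=> full [x0 t0] [/= x01 _] t y /=; rewrite in_itv/= => y01.
rewrite in_itv/= in x01.
move=> B /nbhs_ballP[e /= e0 eB].
have d0 : 0 < Num.min e (1 - y) by rewrite lt_min e0 subr_gt0; case/andP: y01.
have de : Num.min e (1 - y) <= e by rewrite ge_min lexx.
have d1 : Num.min e (1 - y) <= 1 - y by rewrite ge_min lexx orbT.
have : t \in [set: 'Z_N]%SET by rewrite inE.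
rewrite -(full x0 t0 y) => /limit_setP/(_ _ d0)[n [k [/= nk nt]]].
set z := x0 + _ + _ in nk.
have z01 : 0 <= z < 1 by lra.
exists z; split; last first.
  by apply: eB; rewrite /ball/= ltr_norml; lra.
split; first by split => //=; rewrite in_itv.
exists n; left; rewrite iter_skew_product// nt; congr (_, _).
by rewrite -(fractD _ k) fract_id.
Qed.

(** The function c t - h(x) is invariant; it vanishes at (0, 0) and equals c on
    [0, alpha[ x {1}, so the orbit of (0, 0) avoids that set. *)
Lemma not_minimal_coboundary N (f : R -> int) alpha (c : 'Z_N) (h : R -> 'Z_N) :
  0 < alpha < 1 -> c != 0 ->
  (forall x, 0 <= x < 1 -> c * (f x)%:~R = h (rotation alpha x) - h x) ->
  (forall x, 0 <= x < alpha -> h x = 0) ->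
  ~ minimal (@skew_product R N (rotation alpha) f).
Proof.
move=> a01 c0 fh h0 Tmin.
have inv n x t : 0 <= x < 1 ->
    let p := iter n (skew_product (rotation alpha) f) (x, t) in
    0 <= p.1 < 1 /\ c * p.2 - h p.1 = c * t - h x.
  move=> x01 /=; elim: n => [|n [IH1 IH2]] //=.
  split; first exact: fract_itv.
  by rewrite mulrDr fh// -IH2; ring.
have z01 : 0 <= (0 : R) < 1 by rewrite lexx ltr01.
have p0 : phase_space (0 : R, 0 : 'Z_N) by split => //=; rewrite in_itv.
have a2 : `[0, 1[%classic (alpha / 2) by rewrite /= in_itv/=; lra.
have a20 : 0 < alpha / 2 by lra.
have [y [[[/= y01 _] [n yO]] yb]] :=
  Tmin _ p0 1 _ a2 _ (nbhsx_ballx (alpha / 2) _ a20).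
rewrite in_itv/= in y01.
have ya : h y = 0 by apply: h0; move: yb; rewrite /ball/= ltr_norml; lra.
have h00 : h 0 = 0 by apply: h0; lra.
case: yO => yO; [have [_] := inv n 0 0 z01|have [_] := inv n y 1 y01];
  rewrite yO/= h00 ya !subr0 mulr0 mulr1; first by move/eqP; rewrite (negbTE c0).
by move/esym/eqP; rewrite (negbTE c0).
Qed.

End Lift.

(** * Coboundaries with jumps at the multiples of alpha *)

Section Staircase.
Context {R : realType} {N : nat}.
Implicit Types (x alpha : R).

(** The transfer function is the staircase that climbs by c f(i alpha) at
    (i + 1) alpha; it is back to 0 on [L alpha, 1[ because the steps add up to 0,
    so it is well defined on the circle. *)
Lemma not_minimal_staircase (f : R -> int) alpha L (c : 'Z_N) :
  0 < alpha < 1 -> L%:R * alpha < 1 -> c != 0 ->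
  (forall i x, (i < L)%N -> i%:R * alpha <= x < i.+1%:R * alpha ->
    c * (f x)%:~R = c * (f (i%:R * alpha))%:~R) ->
  (forall x, L%:R * alpha <= x < 1 -> c * (f x)%:~R = 0) ->
  \sum_(i < L) c * (f (i%:R * alpha))%:~R = 0 ->
  ~ minimal (@skew_product R N (rotation alpha) f).
Proof.
move=> a01 La c0 fstep fend fsum; have [a0 a1] := andP a01.
pose b i : 'Z_N := c * (f (i%:R * alpha))%:~R.
pose h x : 'Z_N := \sum_(i < L) if i.+1%:R * alpha <= x then b i else 0.
have h0 x : x < alpha -> h x = 0.
  move=> xa; apply: big1 => i _; rewrite leNgt (lt_le_trans xa)//.
  by rewrite -[leLHS]mul1r ler_pM2r// ler1n.
have h1 x : L%:R * alpha <= x -> h x = 0.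
  move=> Lx; rewrite -[RHS]fsum; apply: eq_bigr => i _; rewrite ifT//.
  by apply: le_trans Lx; rewrite ler_pM2r// ler_nat.
apply: (@not_minimal_coboundary _ _ _ _ c h) => //; last first.
  by move=> x /andP[_ /h0].
move=> x x01.
(* When x + alpha >= 1 both sides vanish: the point is past L alpha, and its
   reduction is before alpha. *)
have -> : h (rotation alpha x) = h (x + alpha).
  rewrite rotationE//; case: ltP => // xa.
  by rewrite h0 ?h1//; lra.
have hD : h (x + alpha) =
    \sum_(i < L) if i%:R * alpha <= x then b i else 0.
  by apply: eq_bigr => i _; rewrite -natr1 mulrDl mul1r lerD2r.
rewrite hD /h -sumrB.
have term (i : 'I_L) : (if i%:R * alpha <= x then b i else 0) -
    (if i.+1%:R * alpha <= x then b i else 0) =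
    if i%:R * alpha <= x < i.+1%:R * alpha then b i else 0.
  have [ix|ix] := leP (i.+1%:R * alpha) x.
    by rewrite ifT ?andbF ?subrr//; apply: le_trans ix; rewrite ler_pM2r// ler_nat.
  by rewrite andbT subr0.
rewrite (eq_bigr _ (fun i _ => term i)).
have [Lx|xL] := leP (L%:R * alpha) x.
  rewrite fend; last by rewrite Lx; case/andP: x01.
  rewrite big1// => i _; rewrite ifF//; apply/negbTE/negP => /andP[_ ].
  by rewrite ltNge (le_trans _ Lx)// ler_pM2r// ler_nat.
have x0 : 0 <= x / alpha by rewrite divr_ge0 ?(ltW a0)//; case/andP: x01.
have := truncn_itv x0; rewrite ler_pdivlMr// ltr_pdivrMr//.
set i0 := Num.truncn _ => i0x.
have i0L : (i0 < L)%N.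
  by rewrite -(ltr_nat R) -(ltr_pM2r a0); case/andP: i0x => /le_lt_trans ->.
rewrite (bigD1 (Ordinal i0L))//= i0x (fstep i0)//.
rewrite big1 ?addr0// => i; rewrite -val_eqE/= => ii0.
rewrite ifF//; apply/negbTE/negP => /andP[ix xi].
case/andP: i0x => i0x xi0; case/negP: ii0; rewrite eqn_leq.
apply/andP; split; rewrite -ltnS -(ltr_nat R) -(ltr_pM2r a0).
  exact: le_lt_trans xi0.
exact: le_lt_trans xi.
Qed.

End Staircase.

(** * Step functions with three values *)

Section ThreeSteps.
Context {R : realType} (zeta1 zeta2 : R) (a1 a2 a3 : int).
Context (hzeta : [/\ 0 < zeta1, zeta1 < zeta2 & zeta2 < 1]).
Implicit Types (x y alpha : R).

(** Left limits of the step function are its values for right-closed intervals;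
    accordingly [left_fract] reduces modulo 1 into ]0, 1]. *)
Definition left_step3 x : int :=
  if x <= zeta1 then a1 else if x <= zeta2 then a2 else a3.

Definition left_fract x : R := x - (Num.ceil x)%:~R + 1.

Lemma left_fract_itv x : 0 < left_fract x <= 1.
Proof. by have := ceil_itv x; rewrite /left_fract intrB; lra. Qed.

Lemma left_fractD x (k : int) : left_fract (x + k%:~R) = left_fract x.
Proof.
have := ceil_itv x; rewrite intrB => xk; rewrite /left_fract.
rewrite (@ceil_def _ _ (Num.ceil x + k)) ?intrB intrD; lra.
Qed.

Context (N : nat).
Definition lift_step3 x : 'Z_N := (step3 zeta1 zeta2 a1 a2 a3 (fract x))%:~R.

Definition side_step3 s x : 'Z_N :=
  if s then lift_step3 x else (left_step3 (left_fract x))%:~R.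

Lemma lift_step3D x (k : int) : lift_step3 (x + k%:~R) = lift_step3 x.
Proof. by rewrite /lift_step3 fractD. Qed.

Lemma side_step3D s x (k : int) : side_step3 s (x + k%:~R) = side_step3 s x.
Proof. by case: s; rewrite /side_step3 /= ?lift_step3D// left_fractD. Qed.

Lemma side_step3_near s x : exists2 e, 0 < e &
  forall y, near_side s x e y -> lift_step3 y = side_step3 s x.
Proof.
have [z1 z12 z2] := hzeta.
case: s; rewrite /side_step3/= /lift_step3.
  have := fract_itv x; set u := fract x => u01.
  have fy y : x < y -> y < x + (1 - u) -> fract y = u + (y - x).
    move=> xy yx; rewrite (@fract_def _ _ (Num.floor x)); move: u01 yx.
      by rewrite /u /fract; lra.
    by rewrite /u /fract; lra.
  rewrite /step3; case: (ltP u zeta1) => [u1|u1].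
    exists (zeta1 - u) => [|y /andP[xy ye]]; first by rewrite subr_gt0.
    by rewrite fy; [rewrite ifT//; lra| |]; lra.
  case: (ltP u zeta2) => [u2|u2].
    exists (zeta2 - u) => [|y /andP[xy ye]]; first by rewrite subr_gt0.
    by rewrite fy; [rewrite ifF 1?ifT//; lra| |]; lra.
  exists (1 - u) => [|y /andP[xy ye]]; first by lra.
  by rewrite fy; [rewrite ifF 1?ifF//; lra| |]; lra.
have := left_fract_itv x; set u := left_fract x => u01.
have fy y : x - u < y -> y < x -> fract y = u + (y - x).
  move=> xy yx; rewrite (@fract_def _ _ (Num.ceil x - 1)); move: u01 xy.
    by rewrite /u /left_fract intrB; lra.
  by rewrite /u /left_fract intrB; lra.
rewrite /step3 /left_step3; case: (leP u zeta1) => [u1|u1].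
  exists u => [|y /andP[xy ye]]; first by case/andP: u01.
  by rewrite fy; [rewrite ifT//; lra| |]; lra.
case: (leP u zeta2) => [u2|u2].
  exists (u - zeta1) => [|y /andP[xy ye]]; first by rewrite subr_gt0.
  by rewrite fy; [rewrite ifF 1?ifT//; lra| |]; lra.
exists (u - zeta2) => [|y /andP[xy ye]]; first by rewrite subr_gt0.
by rewrite fy; [rewrite ifF 1?ifF//; lra| |]; lra.
Qed.

Lemma side_step3_jump x : side_step3 true x <> side_step3 false x ->
  exists k : int, [\/ x = k%:~R, x = zeta1 + k%:~R | x = zeta2 + k%:~R].
Proof.
apply: contra_notP => nx; rewrite /side_step3/= /lift_step3.
have xk z : x = z + (Num.floor x)%:~R -> z <> 0 /\ z <> zeta1 /\ z <> zeta2.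
  move=> xE; split=> [z0|]; [|split=> [z1|z2]]; apply: nx; exists (Num.floor x).
  - by apply: Or31; rewrite {1}xE z0 add0r.
  - by apply: Or32; rewrite {1}xE z1.
  - by apply: Or33; rewrite {1}xE z2.
have [|/eqP u0 [/eqP u1 /eqP u2]] := xk (fract x); first by rewrite /fract subrK.
have u01 := fract_itv x.
have -> : left_fract x = fract x.
  have u0' : 0 < fract x by rewrite lt_neqAle eq_sym u0; case/andP: u01.
  rewrite /left_fract (@ceil_def _ _ (Num.floor x + 1)) intrD ?intrB ?intrD.
    by rewrite /fract; lra.
  by move: u0' u01; rewrite /fract; lra.
by rewrite /step3 /left_step3 !le_eqVlt (negbTE u1) (negbTE u2).
Qed.

Lemma side_step3_left0 : side_step3 false 0 = a3%:~R.
Proof.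
have [z1 z12 z2] := hzeta.
rewrite /side_step3/= /left_fract ceil0 subr0 add0r /left_step3.
by rewrite !ifF//; lra.
Qed.

Lemma step3_1 x : x < zeta1 -> step3 zeta1 zeta2 a1 a2 a3 x = a1.
Proof. by rewrite /step3 => ->. Qed.

Lemma step3_2 x : zeta1 <= x < zeta2 -> step3 zeta1 zeta2 a1 a2 a3 x = a2.
Proof. by move=> hx; rewrite /step3 ifF 1?ifT//; lra. Qed.

Lemma step3_3 x : zeta2 <= x -> step3 zeta1 zeta2 a1 a2 a3 x = a3.
Proof.
by have [_ z12 _] := hzeta => hx; rewrite /step3 !ifF//; lra.
Qed.

Lemma lift_step3E x : 0 <= x < 1 ->
  lift_step3 x = (step3 zeta1 zeta2 a1 a2 a3 x)%:~R.
Proof. by move=> x01; rewrite /lift_step3 fract_id. Qed.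

Lemma left_fract_id x : 0 < x <= 1 -> left_fract x = x.
Proof.
by move=> x01; rewrite /left_fract (@ceil_def _ _ 1) ?subrK.
Qed.

Lemma side_step3_zeta1 :
  side_step3 true zeta1 - side_step3 false zeta1 = (a2 - a1)%:~R.
Proof.
have [z1 z12 z2] := hzeta.
rewrite /side_step3 lift_step3E; last by lra.
rewrite left_fract_id; last by lra.
by rewrite step3_2 ?lexx// intrB /left_step3 lexx.
Qed.

Lemma side_step3_zeta2 :
  side_step3 true zeta2 - side_step3 false zeta2 = (a3 - a2)%:~R.
Proof.
have [z1 z12 z2] := hzeta.
rewrite /side_step3 lift_step3E; last by lra.
rewrite left_fract_id; last by lra.
rewrite step3_3 ?lexx// intrB /left_step3 lexx ifF//.
by rewrite leNgt z12.
Qed.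

(** The periods of an arbitrary set A stand for those of the limit set at 0: what
    has to be checked in each case is only that the three families of periods
    generate the entries of the gcd. *)
Lemma minimal_step3 alpha L xi (s : seq int) :
  irrational alpha -> 0 < alpha < 1 -> L%:R * alpha < 1 ->
  (forall z, z \in [:: 0; zeta1; zeta2] ->
     (exists2 i, (i <= L)%N & z = i%:R * alpha) \/ (~ Zspan alpha xi /\ z = xi)) ->
  (forall A : {set 'Z_N}, period A a3%:~R ->
    period A (\sum_(i < L) lift_step3 (i%:R * alpha)) ->
    (forall x, ~ Zspan alpha x ->
      period A (side_step3 true x - side_step3 false x)) ->
    forall a, a \in s -> period A a%:~R) ->
  gcdzs s = 1 ->
  minimal (@skew_product R N (rotation alpha) (step3 zeta1 zeta2 a1 a2 a3)).
Proof.
move=> irr a01 La disc per gcd1; have [a0 _] := andP a01.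
apply: minimal_limit_set => x0 t0 x.
have discF y : side_step3 true y <> side_step3 false y ->
    (exists (i : nat) (k : int), (i <= L)%N /\ y = i%:R * alpha + k%:~R) \/
    (~ Zspan alpha xi /\ exists k : int, y = xi + k%:~R).
  move=> /side_step3_jump[k yk].
  have {yk} [z zz ->] : exists2 z, z \in [:: 0; zeta1; zeta2] & y = z + k%:~R.
    case: yk => ->; [exists 0|exists zeta1|exists zeta2];
      by rewrite ?add0r// !inE eqxx ?orbT.
  by case: (disc z zz) => [[i iL ->]|[xiN ->]]; [left; exists i, k|right; split => //; exists k].
have P1 := period_left_limit0 irr lift_step3D side_step3D side_step3_near x0 t0
  discF a0 La.
have P2 := period_sum irr lift_step3D side_step3D side_step3_near x0 t0
  discF a0 La.
have P3 := period_transverse irr lift_step3D side_step3D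
  side_step3_near x0 t0 discF.
rewrite side_step3_left0 in P1.
have := period_gcdzs (per _ P1 P2 P3); rewrite gcd1 => S1.
have Sneq0 := limit_set_neq0 irr lift_step3 x0 t0 true 0.
have full := period1_full Sneq0 S1.
apply/eqP; rewrite finset.eqEcard finset.subsetT/= -full.
by rewrite (card_limit_set irr lift_step3D side_step3_near x0 t0 true 0 true x).
Qed.

End ThreeSteps.

(** * The three cases *)

Theorem proposition12 (R : realType) (alpha : R) (N : nat)
    (zeta1 zeta2 : R) (a1 a2 a3 : int)
    (halpha : 0 < alpha < 1) (halpha_irr : irrational alpha)
    (hN : (2 <= N)%N)
    (hzeta : [/\ 0 < zeta1, zeta1 < zeta2 & zeta2 < 1]) :
  let Tf := @skew_product R N (rotation alpha) (step3 zeta1 zeta2 a1 a2 a3) in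
  [/\ (zeta1 = 2 * alpha -> ~ Zspan alpha zeta2 ->
        (minimal Tf <-> gcdzs [:: N%:Z; 2 * a1; a2; a3] = 1)),
      (zeta2 = 2 * alpha -> ~ Zspan alpha zeta1 ->
        (minimal Tf <-> gcdzs [:: N%:Z; a1 + a2; 2 * a2; a3] = 1))
    & (zeta1 = 2 * alpha -> zeta2 = 3 * alpha ->
        (minimal Tf <-> gcdzs [:: N%:Z; 2 * a1 + a2; a3] = 1))].
Proof.
move=> Tf; have [a0 a_lt1] := andP halpha; have [z1 z12 z2] := hzeta.
have NA (A : {set 'Z_N}) : period A N%:Z%:~R.
  by rewrite -pmulrn pchar_Zp//; exact: period0.
have f1 := @step3_1 R zeta1 zeta2 a1 a2 a3.
have f2 := @step3_2 R zeta1 zeta2 a1 a2 a3.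
have f3 := @step3_3 R zeta1 zeta2 a1 a2 a3 hzeta.
have lE x := @lift_step3E R zeta1 zeta2 a1 a2 a3 N x.
split=> [z1E z2N|z2E z1N|z1E z2E].
- have La : 2%:R * alpha < 1 by lra.
  split=> [Tmin|].
    apply: contrapT => g1; case: (common_annihilator hN g1) => c c0 cs.
    have c1 : c * (2 * a1)%:~R = 0 by apply: cs; rewrite !inE eqxx.
    have c2 : c * a2%:~R = 0 by apply: cs; rewrite !inE eqxx orbT.
    have c3 : c * a3%:~R = 0 by apply: cs; rewrite !inE eqxx !orbT.
    apply: (not_minimal_staircase halpha La c0 _ _ _ Tmin).
    + move=> [|[|//]] x _ hx; rewrite !f1//; lra.
    + move=> x hx; have [xz|zx] := ltP x zeta2; last by rewrite f3.
      by rewrite f2 ?c2//; lra.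
    + rewrite !big_ord_recr big_ord0/= add0r.
      rewrite (f1 (0%:R * alpha)); last by lra.
      rewrite (f1 (1%:R * alpha)); last by lra.
      by rewrite -c1 -mulrDr -intrD; congr (_ * _%:~R); ring.
  apply: (@minimal_step3 _ _ _ a1 a2 a3 hzeta N alpha 2 zeta2) => //.
    move=> z; rewrite !inE => /or3P[]/eqP->; [left|left|by right].
      by exists 0%N; rewrite ?mul0r.
    by exists 2%N.
  move=> A A3 Asum Atr.
  have A1 : period A (2 * a1)%:~R.
    move: Asum; rewrite !big_ord_recr big_ord0/= add0r.
    rewrite (lE (0%:R * alpha)); last by lra.
    rewrite (lE (1%:R * alpha)); last by lra.
    rewrite (f1 (0%:R * alpha)); last by lra.
    rewrite (f1 (1%:R * alpha)); last by lra.
    by rewrite -intrD; congr (period _ _%:~R); ring.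
  have := Atr _ z2N; rewrite side_step3_zeta2// => A23.
  have A2 : period A a2%:~R.
    by have := periodB A3 A23; rewrite -intrB; congr (period _ _%:~R); ring.
  by move=> a; rewrite !inE => /or4P[]/eqP->.
- have La : 2%:R * alpha < 1 by lra.
  split=> [Tmin|].
    apply: contrapT => g1; case: (common_annihilator hN g1) => c c0 cs.
    have c12 : c * (a1 + a2)%:~R = 0 by apply: cs; rewrite !inE eqxx.
    have c2 : c * (2 * a2)%:~R = 0 by apply: cs; rewrite !inE eqxx orbT.
    have c3 : c * a3%:~R = 0 by apply: cs; rewrite !inE eqxx !orbT.
    have c1 : c * a1%:~R = c * a2%:~R.
      apply/eqP; rewrite -subr_eq0 -mulrBr -intrB.
      have -> : a1 - a2 = (a1 + a2) - 2 * a2 by ring.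
      by rewrite intrB mulrBr c12 c2 subrr.
    have cE x : x < zeta2 -> c * (step3 zeta1 zeta2 a1 a2 a3 x)%:~R = c * a2%:~R.
      by move=> xz; rewrite /step3 xz; case: ifP.
    apply: (not_minimal_staircase halpha La c0 _ _ _ Tmin).
    + by move=> [|[|//]] x _ hx; rewrite !cE//; lra.
    + by move=> x hx; rewrite f3//; lra.
    + rewrite !big_ord_recr big_ord0/= add0r.
      rewrite (cE (0%:R * alpha)); last by lra.
      rewrite (cE (1%:R * alpha)); last by lra.
      by rewrite -c2 -mulrDr -intrD; congr (_ * _%:~R); ring.
  apply: (@minimal_step3 _ _ _ a1 a2 a3 hzeta N alpha 2 zeta1) => //.
    move=> z; rewrite !inE => /or3P[]/eqP->; [left|by right|left].
      by exists 0%N; rewrite ?mul0r.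
    by exists 2%N.
  move=> A A3 Asum Atr.
  have := Atr _ z1N; rewrite side_step3_zeta1// => A12.
  have A1 : period A (a1 + a2)%:~R /\ period A (2 * a2)%:~R.
    move: Asum; rewrite !big_ord_recr big_ord0/= add0r.
    rewrite (lE (0%:R * alpha)); last by lra.
    rewrite (lE (1%:R * alpha)); last by lra.
    rewrite (f1 (0%:R * alpha)); last by lra.
    (* The point zeta1 may lie on either side of alpha; a2 - a1 being a period,
       both values give the same conclusion. *)
    have [az|za] := ltP (1%:R * alpha) zeta1.
      rewrite f1// => A11.
      split.
        by have := periodD A11 A12; rewrite -!intrD; congr (period _ _%:~R); ring.
      have := periodD (periodD A11 A12) A12.
      by rewrite -!intrD; congr (period _ _%:~R); ring.
    rewrite (f2 (1%:R * alpha)); last by lra.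
    move=> A11; split; first by rewrite intrD.
    by have := periodD A11 A12; rewrite -!intrD; congr (period _ _%:~R); ring.
  by move=> a; rewrite !inE => /or4P[]/eqP-> //; case: A1.
- have La : 3%:R * alpha < 1 by lra.
  split=> [Tmin|].
    apply: contrapT => g1; case: (common_annihilator hN g1) => c c0 cs.
    have c12 : c * (2 * a1 + a2)%:~R = 0 by apply: cs; rewrite !inE eqxx.
    have c3 : c * a3%:~R = 0 by apply: cs; rewrite !inE eqxx !orbT.
    apply: (not_minimal_staircase halpha La c0 _ _ _ Tmin).
    + move=> [|[|[|//]]] x _ hx.
      * by rewrite !f1//; lra.
      * by rewrite !f1//; lra.
      * rewrite (f2 x); last by lra.
        by rewrite (f2 (2%:R * alpha)); last by lra.
    + by move=> x hx; rewrite f3//; lra.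
    + rewrite !big_ord_recr big_ord0/= add0r.
      rewrite (f2 (2%:R * alpha)); last by lra.
      rewrite (f1 (0%:R * alpha)); last by lra.
      rewrite (f1 (1%:R * alpha)); last by lra.
      by rewrite -c12 -!mulrDr -!intrD; congr (_ * _%:~R); ring.
  (* Every discontinuity is a multiple of alpha, so 0 is an arbitrary value for the
     point xi. *)
  apply: (@minimal_step3 _ _ _ a1 a2 a3 hzeta N alpha 3 0) => //.
    move=> z; rewrite !inE => /or3P[]/eqP->; left.
    - by exists 0%N; rewrite ?mul0r.
    - by exists 2%N.
    - by exists 3%N.
  move=> A A3 Asum _.
  have A1 : period A (2 * a1 + a2)%:~R.
    move: Asum; rewrite !big_ord_recr big_ord0/= add0r.
    rewrite (lE (2%:R * alpha)); last by lra.
    rewrite (lE (0%:R * alpha)); last by lra.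
    rewrite (lE (1%:R * alpha)); last by lra.
    rewrite (f2 (2%:R * alpha)); last by lra.
    rewrite (f1 (0%:R * alpha)); last by lra.
    rewrite (f1 (1%:R * alpha)); last by lra.
    by rewrite -!intrD; congr (period _ _%:~R); ring.
  by move=> a; rewrite !inE => /or3P[]/eqP->.
Qed.
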